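(* Let $x \in \left(0, \frac{\pi}{2}\right]$. Then: (i) For every $q_1 \in \left(0, \frac{\pi^2}{4}-1\right] = (0, 1.46740\ldots]$ and every $q_2 \in \left(0, \frac{2}{\pi-2}\right] = (0, 1.75193\ldots]$, it holds $$\frac{2}{\pi} + \frac{2}{q_1\pi^{q_1+1}}\left(\pi^{q_1} - (2x)^{q_1}\right) \geq \frac{\sin x}{x} \geq \frac{2}{\pi} + \frac{\pi-2}{\pi^{q_2+1}}\left(\pi^{q_2} - (2x)^{q_2}\right).$$ (ii) For every $q_1 \in \left[\frac{2}{\pi-2}, +\infty\right) = [1.75193\ldots, +\infty)$ and every $q_2 \in [2, +\infty)$, it holds $$\frac{2}{\pi} + \frac{2}{q_1\pi^{q_1+1}}\left(\pi^{q_1} - (2x)^{q_1}\right) \leq \frac{\sin x}{x} \leq \frac{2}{\pi} + \frac{\pi-2}{\pi^{q_2+1}}\left(\pi^{q_2} - (2x)^{q_2}\right).$$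
   Context: The parameters $q_1, q_2$ are real numbers, chosen independently of each other. *)

(* Defs.v *)
(* Real powers a^q are Stdlib's [Rpower a q] = exp (q * ln a), which is the
   usual power only for a > 0; the bases used are PI and 2 * x, x > 0. *)
From Stdlib Require Import Reals.

(* Main.v *)
Require Import Defs.
From Stdlib Require Import Reals.
From Stdlib Require Import Lra.
From Coquelicot Require Import Coquelicot.
Open Scope R_scope.

(** Put [t = 2 * x / PI] in (0, 1]. After division by powers of [PI], the two
    families of bounds are [2/PI + 2/(PI*q) * (1 - t^q)], which has the value
    and the slope of [sin x / x] at [PI/2], and
    [2/PI + (PI-2)/PI * (1 - t^q) = 1 - (1 - 2/PI) * t^q], which has the right
    values at [0] and at [PI/2]. They coincide for [q = 2/(PI-2)].

    Three of the four inequalities say that a function [N] with an explicit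
    value at [PI/2] lies below its comparison power [N (PI/2) * t^r], or
    integrate such a bound. By [power_comparison] it is enough to bound the
    logarithmic slope, [r * N u <= u * N' u]:
    - for [N = sin u - u * cos u], which is [- u^2] times the derivative of
      [sin u / u], the slope [u^2 * sin u / N] is at least [PI^2/4]
      ([log_slope_sin_minus_xcos]), whence the first bound of (i) by one
      integration;
    - for [N = u - sin u], the slope is at least [PI/(PI-2) = 2/(PI-2) + 1]
      ([log_slope_x_minus_sin_lower]), whence the second bound of (i);
    - for the same function, the slope is at most [3]
      ([log_slope_x_minus_sin_upper]), which is the condition for the negative
      function [sin u - u] and gives the second bound of (ii).
    The first bound of (ii) follows from the second bound of (i) at the common
    exponent [2/(PI-2)], because [(1 - t^q) / q] decreases in [q].

    The two lower slope bounds are sharp at [PI/2], so the difference of their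
    sides vanishes at both ends of [0, PI/2]. Its derivative, or its second
    derivative, is a nonnegative factor times [x * cos x - c * sin x], which
    passes from nonnegative to negative at most once; the difference is
    therefore nonnegative in between ([nonneg_of_derivative_sign]). *)

(** * Sign changes of derivatives *)

(** [h] first increases and then decreases, so it is at least the smaller of
    its end values. The hypothesis on [h'] avoids naming the turning point: one
    looks at the sign of [h'] at [x] and compares with the end on whose side
    that sign persists. *)
Lemma nonneg_of_derivative_sign (h h' : R -> R) (a b : R) :
  (forall u, is_derive h u (h' u)) ->
  0 <= h a -> 0 <= h b ->
  (forall u v, a < u < v -> v < b -> 0 <= h' v -> 0 <= h' u) ->
  forall x, a <= x <= b -> 0 <= h x.
Proof.
  intros Hd Ha Hb Hs x [Hax Hxb].
  destruct Hax as [Hax | <-]; [ | exact Ha].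
  destruct Hxb as [Hxb | ->]; [ | exact Hb].
  destruct (Rle_lt_dec 0 (h' x)) as [Hx | Hx].
  - destruct (MVT_cor2 h h' a x Hax) as [c [Hc [Hac Hcx]]].
    { intros; apply is_derive_Reals, Hd. }
    assert (0 <= h' c) by (apply (Hs c x); lra).
    nra.
  - destruct (MVT_cor2 h h' x b Hxb) as [c [Hc [Hxc Hcb]]].
    { intros; apply is_derive_Reals, Hd. }
    assert (h' c < 0).
    { apply Rnot_le_lt; intro Hc'.
      assert (0 <= h' x) by (apply (Hs x c); lra). lra. }
    nra.
Qed.

Lemma nonneg_of_derivative_nonneg (h h' : R -> R) (a x : R) :
  (forall u, is_derive h u (h' u)) -> 0 <= h a ->
  (forall u, a < u < x -> 0 <= h' u) -> a <= x -> 0 <= h x.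
Proof.
  intros Hd Ha Hs [Hax | <-]; [ | exact Ha].
  destruct (MVT_cor2 h h' a x Hax) as [c [Hc Hacx]].
  { intros; apply is_derive_Reals, Hd. }
  specialize (Hs c Hacx). nra.
Qed.

(** * Trigonometric inequalities on the first quadrant *)

Lemma sin_cos_nonneg (x : R) : 0 <= x <= PI / 2 -> 0 <= sin x /\ 0 <= cos x.
Proof.
  intros Hx; pose proof PI_RGT_0.
  split; [apply sin_ge_0 | apply cos_ge_0]; lra.
Qed.

(** [x * cos x - c * sin x] vanishes at [0], and its derivative
    [(1 - c) * cos x - x * sin x] decreases if [c <= 1] and is negative if
    [c > 1]. *)
Lemma xcos_minus_sin_sign (c u v : R) :
  0 < u < v -> v < PI / 2 ->
  0 <= v * cos v - c * sin v -> 0 <= u * cos u - c * sin u.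
Proof.
  intros Huv Hv Hk.
  apply (nonneg_of_derivative_sign (fun x => x * cos x - c * sin x)
           (fun x => (1 - c) * cos x - x * sin x) 0 v); [ | | exact Hk | | lra].
  - intros w; auto_derive; [easy | ring].
  - rewrite sin_0; lra.
  - intros w z Hwz Hz H.
    destruct (sin_cos_nonneg w) as [Sw Cw]; [lra | ].
    destruct (sin_cos_nonneg z) as [Sz Cz]; [lra | ].
    assert (Hsin : 0 < sin z) by (apply sin_gt_0; lra).
    assert (Hc : c <= 1).
    { apply Rnot_lt_le; intro Hc.
      assert (0 <= (c - 1) * cos z) by (apply Rmult_le_pos; lra).
      assert (0 < z * sin z) by (apply Rmult_lt_0_compat; lra). lra. }
    assert (Hcos : cos z <= cos w) by (apply cos_decr_1; lra).
    assert (sin w <= sin z) by (apply sin_incr_1; lra).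
    assert (w * sin w <= z * sin z) by (apply Rmult_le_compat; lra).
    assert ((1 - c) * cos z <= (1 - c) * cos w)
      by (apply Rmult_le_compat_l; lra).
    lra.
Qed.

Lemma xcos_le_sin (x : R) : 0 <= x <= PI / 2 -> 0 <= sin x - x * cos x.
Proof.
  intros Hx.
  apply (nonneg_of_derivative_nonneg (fun x => sin x - x * cos x)
           (fun x => x * sin x) 0); [ | | | lra].
  - intros w; auto_derive; [easy | ring].
  - rewrite sin_0; lra.
  - intros w Hw; destruct (sin_cos_nonneg w); [lra | ].
    apply Rmult_le_pos; lra.
Qed.

Lemma log_slope_sin_minus_xcos (x : R) :
  0 <= x <= PI / 2 -> PI ^ 2 / 4 * (sin x - x * cos x) <= x * (x * sin x).
Proof.
  intros Hx.
  enough (0 <= x * (x * sin x) - PI ^ 2 / 4 * (sin x - x * cos x)) by lra.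
  apply (nonneg_of_derivative_sign
           (fun x => x * (x * sin x) - PI ^ 2 / 4 * (sin x - x * cos x))
           (fun x => x * (x * cos x - (PI ^ 2 / 4 - 2) * sin x)) 0 (PI / 2));
    [ | | | | exact Hx].
  - intros w; auto_derive; [easy | field].
  - rewrite sin_0; lra.
  - rewrite sin_PI2, cos_PI2; lra.
  - intros u v Huv Hv H.
    apply Rmult_le_pos; [lra | ].
    apply (xcos_minus_sin_sign _ u v Huv Hv).
    apply (Rmult_le_reg_l v); lra.
Qed.

(** The first derivative of the difference,
    [(PI - 2) * x * sin x - 2 * (1 - cos x)], is not yet a multiple of
    [x * cos x - c * sin x], but the second one is. The sign argument is
    therefore used twice: on [0, v], where the first derivative vanishes at [0]
    and is nonnegative at [v] by assumption, it yields the sign condition for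
    the argument on [0, PI/2]. *)
Lemma log_slope_x_minus_sin_lower (x : R) :
  0 <= x <= PI / 2 -> (2 / (PI - 2) + 1) * (x - sin x) <= x * (1 - cos x).
Proof.
  intros Hx. pose proof PI2_3_2 as Hpi.
  enough (H : 0 <= (PI - 2) * (x * (1 - cos x)) - PI * (x - sin x)).
  { apply (Rmult_le_reg_l (PI - 2)); [lra | ].
    replace ((PI - 2) * ((2 / (PI - 2) + 1) * (x - sin x)))
      with (PI * (x - sin x)) by (field; lra).
    lra. }
  apply (nonneg_of_derivative_sign
           (fun x => (PI - 2) * (x * (1 - cos x)) - PI * (x - sin x))
           (fun x => (PI - 2) * (x * sin x) - 2 * (1 - cos x)) 0 (PI / 2));
    [ | | | | exact Hx].
  - intros w; auto_derive; [easy | ring].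
  - rewrite sin_0; lra.
  - rewrite sin_PI2, cos_PI2; lra.
  - intros u v Huv Hv H.
    apply (nonneg_of_derivative_sign
             (fun x => (PI - 2) * (x * sin x) - 2 * (1 - cos x))
             (fun x => (PI - 2) * (x * cos x - (4 - PI) / (PI - 2) * sin x))
             0 v); [ | | exact H | | lra].
    + intros w; auto_derive; [easy | field; lra].
    + rewrite cos_0; lra.
    + intros w z Hwz Hz H'.
      apply Rmult_le_pos; [lra | ].
      apply (xcos_minus_sin_sign _ w z Hwz); [lra | ].
      apply (Rmult_le_reg_l (PI - 2)); lra.
Qed.

Lemma log_slope_x_minus_sin_upper (x : R) :
  0 <= x <= PI / 2 -> x * (1 - cos x) <= 3 * (x - sin x).
Proof.
  intros Hx.
  enough (0 <= 3 * (x - sin x) - x * (1 - cos x)) by lra.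
  apply (nonneg_of_derivative_nonneg
           (fun x => 3 * (x - sin x) - x * (1 - cos x))
           (fun x => 2 * (1 - cos x) - x * sin x) 0); [ | | | lra].
  - intros w; auto_derive; [easy | ring].
  - rewrite sin_0; lra.
  - intros u Hu.
    apply (nonneg_of_derivative_nonneg
             (fun x => 2 * (1 - cos x) - x * sin x)
             (fun x => sin x - x * cos x) 0); [ | | | lra].
    + intros w; auto_derive; [easy | ring].
    + rewrite cos_0; lra.
    + intros w Hw; apply xcos_le_sin; lra.
Qed.

Lemma sin_le_x (x : R) : 0 <= x -> sin x <= x.
Proof.
  intros [Hx | <-]; [left; apply sin_lt_x, Hx | rewrite sin_0; lra].
Qed.

(** * Comparison with powers *)

Lemma Rpower_1_l (q : R) : Rpower 1 q = 1.
Proof. unfold Rpower; rewrite ln_1, Rmult_0_r; apply exp_0. Qed.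

Lemma is_derive_Rpower (q b u : R) :
  0 < u -> 0 < b ->
  is_derive (fun u => Rpower (u / b) q) u (q / u * Rpower (u / b) q).
Proof.
  intros Hu Hb; unfold Rpower; auto_derive.
  - apply Rdiv_lt_0_compat; assumption.
  - unfold Rdiv; field; lra.
Qed.

(** The slope condition says that [N u * (u / b)^(-r)] increases. *)
Lemma power_comparison (N N' : R -> R) (r b x : R) :
  0 < x <= b ->
  (forall u, is_derive N u (N' u)) ->
  (forall u, x < u < b -> r * N u <= u * N' u) ->
  N x <= N b * Rpower (x / b) r.
Proof.
  intros [Hx Hxb] Hd Hs.
  destruct Hxb as [Hxb | ->].
  2: { unfold Rdiv; rewrite Rinv_r, Rpower_1_l by lra; lra. }
  destruct (MVT_cor2 (fun u => N u * Rpower (u / b) (- r))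
              (fun u => (u * N' u - r * N u) / u * Rpower (u / b) (- r))
              x b Hxb) as [c [Hc Hxcb]].
  { intros c Hc; apply is_derive_Reals.
    evar_last.
    - apply (is_derive_mult N (fun u => Rpower (u / b) (- r)));
        [apply Hd | apply is_derive_Rpower; lra | intros; apply Rmult_comm].
    - unfold plus, mult; simpl; field; lra. }
  replace (b / b) with 1 in Hc by (field; lra).
  rewrite Rpower_1_l in Hc.
  assert (Hpos : 0 <= (c * N' c - r * N c) / c * Rpower (c / b) (- r) * (b - x)).
  { specialize (Hs c Hxcb).
    repeat apply Rmult_le_pos; try lra.
    - left; apply Rinv_0_lt_compat; lra.
    - left; apply exp_pos. }
  rewrite Rpower_Ropp in Hc.
  assert (HP : 0 < Rpower (x / b) r) by apply exp_pos.
  apply (Rmult_le_reg_r (/ Rpower (x / b) r)); [apply Rinv_0_lt_compat, HP | ].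
  rewrite Rmult_assoc, Rinv_r by lra. lra.
Qed.

(** Both sides vanish at [t = 1], and the derivative of their difference in [t]
    is [(t^q - t^r) / t >= 0]. *)
Lemma one_minus_power_over_exponent_decr (q r t : R) :
  0 < q <= r -> 0 < t <= 1 ->
  (1 - Rpower t r) / r <= (1 - Rpower t q) / q.
Proof.
  intros Hqr [Ht [Ht1 | ->]]; [ | rewrite !Rpower_1_l; lra].
  destruct (MVT_cor2
              (fun u => (1 - Rpower u r) / r - (1 - Rpower u q) / q)
              (fun u => (Rpower u q - Rpower u r) / u) t 1 Ht1)
    as [c [Hc Htc]].
  { intros c Hc; apply is_derive_Reals.
    unfold Rpower; auto_derive; [repeat split; lra | field; lra]. }
  rewrite !Rpower_1_l in Hc.
  assert (Hle : Rpower c r <= Rpower c q).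
  { assert (ln c < 0) by (rewrite <- ln_1; apply ln_increasing; lra).
    apply Rnot_lt_le; intro Hlt; apply exp_lt_inv in Hlt. nra. }
  assert (0 <= (Rpower c q - Rpower c r) / c * (1 - t)).
  { repeat apply Rmult_le_pos; try lra.
    left; apply Rinv_0_lt_compat; lra. }
  lra.
Qed.

(** * Bounds for the cardinal sine *)

Lemma sinc_upper_tangent (q x : R) :
  0 < q <= PI ^ 2 / 4 - 1 -> 0 < x <= PI / 2 ->
  sin x / x <= 2 / PI + 2 / PI * ((1 - Rpower (x / (PI / 2)) q) / q).
Proof.
  intros Hq [Hx Hxb]; pose proof PI_RGT_0 as Hpi.
  destruct Hxb as [Hxb | ->].
  2: { replace (PI / 2 / (PI / 2)) with 1 by (field; lra).
       rewrite Rpower_1_l, sin_PI2; right; field; lra. }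
  (* This function differs from the difference of the two sides by a constant;
     it increases by the comparison of [sin u - u * cos u] with a power of
     exponent [q + 1], one more than [q] because of the integration. *)
  destruct (MVT_cor2
              (fun u => sin u / u + 2 / PI * (Rpower (u / (PI / 2)) q / q))
              (fun u => (Rpower (u / (PI / 2)) (q + 1) - (sin u - u * cos u))
                        / u ^ 2) x (PI / 2) Hxb) as [c [Hc Hxc]].
  { intros c Hc; apply is_derive_Reals.
    rewrite Rpower_plus, Rpower_1 by (apply Rdiv_lt_0_compat; lra).
    unfold Rpower; auto_derive.
    - repeat split; try lra. apply Rdiv_lt_0_compat; lra.
    - unfold Rdiv; field; lra. }
  assert (HN : sin c - c * cos c <= Rpower (c / (PI / 2)) (q + 1)).
  { replace (Rpower (c / (PI / 2)) (q + 1))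
      with ((sin (PI / 2) - PI / 2 * cos (PI / 2)) * Rpower (c / (PI / 2)) (q + 1))
      by (rewrite sin_PI2, cos_PI2; ring).
    apply (power_comparison (fun u => sin u - u * cos u) (fun u => u * sin u));
      [lra | intros u; auto_derive; [easy | ring] | ].
    intros u Hu.
    eapply Rle_trans; [ | apply log_slope_sin_minus_xcos; lra].
    apply Rmult_le_compat_r; [apply xcos_le_sin | ]; lra. }
  assert (0 <= (Rpower (c / (PI / 2)) (q + 1) - (sin c - c * cos c)) / c ^ 2
               * (PI / 2 - x)).
  { repeat apply Rmult_le_pos; try lra.
    left; apply Rinv_0_lt_compat, pow_lt; lra. }
  rewrite sin_PI2 in Hc.
  replace (PI / 2 / (PI / 2)) with 1 in Hc by (field; lra).
  rewrite Rpower_1_l in Hc.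
  replace (1 / (PI / 2)) with (2 / PI) in Hc by (field; lra).
  unfold Rdiv in *; lra.
Qed.

(** Restates a bound for [x - sin x] by its comparison power as a bound for the
    cardinal sine. *)
Lemma sinc_chord_difference (q x : R) :
  0 < x ->
  2 / PI + (PI - 2) / PI * (1 - Rpower (x / (PI / 2)) q) - sin x / x
  = (x - sin x - (PI / 2 - 1) * Rpower (x / (PI / 2)) (q + 1)) / x.
Proof.
  intros Hx; pose proof PI_RGT_0.
  rewrite Rpower_plus, Rpower_1 by (apply Rdiv_lt_0_compat; lra).
  field; lra.
Qed.

Lemma sinc_lower_chord (q x : R) :
  q <= 2 / (PI - 2) -> 0 < x <= PI / 2 ->
  2 / PI + (PI - 2) / PI * (1 - Rpower (x / (PI / 2)) q) <= sin x / x.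
Proof.
  intros Hq Hx.
  assert (H : x - sin x <= (PI / 2 - 1) * Rpower (x / (PI / 2)) (q + 1)).
  { replace (PI / 2 - 1) with (PI / 2 - sin (PI / 2)) by (rewrite sin_PI2; ring).
    apply (power_comparison (fun u => u - sin u) (fun u => 1 - cos u));
      [lra | intros u; auto_derive; [easy | ring] | ].
    intros u Hu.
    eapply Rle_trans; [ | apply log_slope_x_minus_sin_lower; lra].
    pose proof (sin_le_x u).
    apply Rmult_le_compat_r; lra. }
  pose proof (sinc_chord_difference q x (proj1 Hx)) as HD.
  assert ((x - sin x - (PI / 2 - 1) * Rpower (x / (PI / 2)) (q + 1)) / x <= 0)
    by (apply Rle_div_l; lra).
  lra.
Qed.

Lemma sinc_upper_chord (q x : R) :
  2 <= q -> 0 < x <= PI / 2 ->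
  sin x / x <= 2 / PI + (PI - 2) / PI * (1 - Rpower (x / (PI / 2)) q).
Proof.
  intros Hq Hx.
  (* An upper bound on the slope of [u - sin u] is a lower bound for its
     negative. *)
  assert (H : sin x - x <= (1 - PI / 2) * Rpower (x / (PI / 2)) (q + 1)).
  { replace (1 - PI / 2) with (sin (PI / 2) - PI / 2) by (rewrite sin_PI2; ring).
    apply (power_comparison (fun u => sin u - u) (fun u => cos u - 1));
      [lra | intros u; auto_derive; [easy | ring] | ].
    intros u Hu.
    assert (u * (1 - cos u) <= 3 * (u - sin u))
      by (apply log_slope_x_minus_sin_upper; lra).
    assert (3 * (u - sin u) <= (q + 1) * (u - sin u)).
    { pose proof (sin_le_x u). apply Rmult_le_compat_r; lra. }
    lra. }
  pose proof (sinc_chord_difference q x (proj1 Hx)) as HD.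
  assert (0 <= (x - sin x - (PI / 2 - 1) * Rpower (x / (PI / 2)) (q + 1)) / x)
    by (apply Rle_div_r; lra).
  lra.
Qed.

(** At [q = 2 / (PI - 2)] the two families of bounds agree. *)
Lemma sinc_lower_tangent (q x : R) :
  2 / (PI - 2) <= q -> 0 < x <= PI / 2 ->
  2 / PI + 2 / PI * ((1 - Rpower (x / (PI / 2)) q) / q) <= sin x / x.
Proof.
  intros Hq Hx; pose proof PI2_3_2.
  eapply Rle_trans; [ | apply (sinc_lower_chord (2 / (PI - 2))); [lra | exact Hx]].
  replace ((PI - 2) / PI * (1 - Rpower (x / (PI / 2)) (2 / (PI - 2))))
    with (2 / PI * ((1 - Rpower (x / (PI / 2)) (2 / (PI - 2))) / (2 / (PI - 2))))
    by (field; lra).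
  apply Rplus_le_compat_l, Rmult_le_compat_l.
  - left; apply Rdiv_lt_0_compat; lra.
  - apply one_minus_power_over_exponent_decr.
    + split; [apply Rdiv_lt_0_compat; lra | exact Hq].
    + split; [apply Rdiv_lt_0_compat; lra | ].
      apply Rle_div_l; lra.
Qed.

(** * The bounds in their original normalisation *)

Lemma Rpower_PI_scaling (q x : R) :
  0 < x ->
  Rpower (2 * x) q = Rpower PI q * Rpower (x / (PI / 2)) q.
Proof.
  intros Hx; pose proof PI_RGT_0.
  rewrite Rpower_mult_distr by (try apply Rdiv_lt_0_compat; lra).
  f_equal; field; lra.
Qed.

Lemma tangent_bound_normalised (q x : R) :
  0 < q -> 0 < x ->
  2 / (q * Rpower PI (q + 1)) * (Rpower PI q - Rpower (2 * x) q)
  = 2 / PI * ((1 - Rpower (x / (PI / 2)) q) / q).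
Proof.
  intros Hq Hx; pose proof PI_RGT_0.
  assert (0 < Rpower PI q) by apply exp_pos.
  rewrite Rpower_PI_scaling, Rpower_plus, Rpower_1 by lra.
  field; lra.
Qed.

Lemma chord_bound_normalised (q x : R) :
  0 < x ->
  (PI - 2) / Rpower PI (q + 1) * (Rpower PI q - Rpower (2 * x) q)
  = (PI - 2) / PI * (1 - Rpower (x / (PI / 2)) q).
Proof.
  intros Hx; pose proof PI_RGT_0.
  assert (0 < Rpower PI q) by apply exp_pos.
  rewrite Rpower_PI_scaling, Rpower_plus, Rpower_1 by lra.
  field; lra.
Qed.

Theorem mainTheorem1 :
  forall x : R, 0 < x <= PI / 2 ->
    (forall q1 q2 : R,
        0 < q1 <= PI ^ 2 / 4 - 1 ->
        0 < q2 <= 2 / (PI - 2) ->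
        2 / PI + 2 / (q1 * Rpower PI (q1 + 1))
                 * (Rpower PI q1 - Rpower (2 * x) q1) >= sin x / x
        /\ sin x / x >=
           2 / PI + (PI - 2) / Rpower PI (q2 + 1)
                    * (Rpower PI q2 - Rpower (2 * x) q2))
    /\
    (forall q1 q2 : R,
        2 / (PI - 2) <= q1 ->
        2 <= q2 ->
        2 / PI + 2 / (q1 * Rpower PI (q1 + 1))
                 * (Rpower PI q1 - Rpower (2 * x) q1) <= sin x / x
        /\ sin x / x <=
           2 / PI + (PI - 2) / Rpower PI (q2 + 1)
                    * (Rpower PI q2 - Rpower (2 * x) q2)).
Proof.
  intros x Hx; split; intros q1 q2 Hq1 Hq2.
  - rewrite tangent_bound_normalised, chord_bound_normalised by lra.
    split; apply Rle_ge; [apply sinc_upper_tangent | apply sinc_lower_chord]; lra.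
  - assert (0 < 2 / (PI - 2))
      by (pose proof PI2_3_2; apply Rdiv_lt_0_compat; lra).
    rewrite tangent_bound_normalised, chord_bound_normalised by lra.
    split; [apply sinc_lower_tangent | apply sinc_upper_chord]; lra.
Qed.
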